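(* Let $G\in\mathcal{G}$, with cliques on $X=\{x_1,\ldots,x_m\}$ and $Y=\{y_1,\ldots,y_n\}$, where $n>m$ and both $n$ and $m$ are odd, such that $N[y_1]=\{x_1,\ldots,x_s\}\cup Y$, $N[y_2]=\{x_{s+1},\ldots,x_{s+t}\}\cup Y$, and $N[y_i]=Y$ for all $3\leq i\leq n$, where $s,t\ge 0$ and $0\leq s+t\leq m$. Then $T_2(G)$ is well-covered.
   Context: $\mathcal{G}$ is the class of graphs obtained by taking the disjoint union of a complete graph $K_m$ with vertex set $X=\{x_1,\ldots,x_m\}$ and a complete graph $K_n$ with vertex set $Y=\{y_1,\ldots,y_n\}$, where $n\geq m$, and then adding some (possibly no) edges each joining a vertex of $X$ to a vertex of $Y$. $N[v]$ denotes the closed neighbourhood of $v$ ($v$ together with all its neighbours). The $2$-token graph $T_2(G)$ has as vertices the $2$-subsets of $V(G)$, two of them adjacent if their symmetric difference is an edge of $G$. A graph is well-covered if all of its maximal (with respect to inclusion) independent sets have the same cardinality. *)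

(* Defs.v *)
From mathcomp Require Import all_boot.

Set Implicit Arguments.
Unset Strict Implicit.
Unset Printing Implicit Defensive.

Record sgraph := SGraph {
  vertex :> finType;
  adj : rel vertex;
  adj_sym : symmetric adj;
  adj_irr : irreflexive adj }.

Section Graph.
Variable G : sgraph.

Definition clique (A : {set G}) : Prop :=
  {in A &, forall u v, u != v -> adj u v}.

Definition cl_nbhd (v : G) : {set G} := v |: [set u | adj v u].

Definition indep (A : {set G}) : bool :=
  [forall u in A, forall v in A, ~~ adj u v].

Definition well_covered : Prop :=
  forall A B : {set G}, maxset indep A -> maxset indep B -> #|A| = #|B|.

Definition symdiff (A B : {set G}) : {set G} := (A :\: B) :|: (B :\: A).

Definition token (k : nat) := {A : {set G} | #|A| == k}.

Definition token_adj (k : nat) : rel (token k) := fun A B =>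
  [exists u, exists v, adj u v && (symdiff (val A) (val B) == [set u; v])].

Lemma token_adj_sym k : symmetric (@token_adj k).
Proof. by move=> A B; rewrite /token_adj /symdiff setUC. Qed.

Lemma token_adj_irr k : irreflexive (@token_adj k).
Proof.
move=> A; apply/negbTE/negP => /existsP[u /existsP[v /andP[_ /eqP E]]].
by have := set21 u v; rewrite -E /symdiff setDv setU0 inE.
Qed.

Definition token_graph (k : nat) : sgraph :=
  SGraph (@token_adj_sym k) (@token_adj_irr k).

(* Membership of G in the class of two-clique graphs, witnessed by
   enumerations x of X and y of Y. The adjacencies between X and Y are
   unconstrained. The enumerations are 0-based: the vertex usually written
   x_i (resp. y_i) is [x (i-1)] (resp. [y (i-1)]). *)
Record two_cliques (m n : nat) (x : 'I_m -> G) (y : 'I_n -> G) : Prop := {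
  two_cliques_le : m <= n;
  two_cliques_injX : injective x;
  two_cliques_injY : injective y;
  two_cliques_disj : [disjoint [set x i | i : 'I_m] & [set y j | j : 'I_n]];
  two_cliques_cover :
    [set x i | i : 'I_m] :|: [set y j | j : 'I_n] = [set: G];
  two_cliques_X : clique [set x i | i : 'I_m];
  two_cliques_Y : clique [set y j | j : 'I_n] }.

End Graph.

(* Main.v *)
Require Import Defs.
From mathcomp Require Import all_boot.
From mathcomp Require Import zify.

Set Implicit Arguments.
Unset Strict Implicit.
Unset Printing Implicit Defensive.

(** View an independent set of [T_2(G)] as a family [F] of pairs of vertices,
    split according to the number [k] of vertices of a pair lying in [X].
    Since [X] and [Y] are cliques, each part is a matching, so [F] has at most
    [m/2], [n/2] and [m] pairs with [k = 2, 0, 1]. If [F] is maximal, all three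
    bounds are attained: otherwise at least three vertices are missed by the
    corresponding matching, every pair that they could form is blocked by a
    pair of [F] from another part, and three such obstructions contradict that
    a vertex of [X] has at most one neighbour in [Y], and that only two
    vertices of [Y] have neighbours in [X]. *)

(** * Pairs, matchings and tournaments on three vertices *)

Section Pairs.
Variable T : finType.
Implicit Types (a b u v w : T) (A B D : {set T}) (P : {set {set T}}).

Lemma card_setI_pair D a b : a != b ->
  #|[set a; b] :&: D| = (a \in D) + (b \in D).
Proof.
move=> ab; rewrite setIUl cardsU.
have card1I c : #|[set c] :&: D| = (c \in D).
  case: (boolP (c \in D)) => cD.
    by rewrite (setIidPl _) ?sub1set // cards1.
  by apply/eqP; rewrite cards_eq0 setI_eq0 disjoints1.
rewrite !card1I; suff -> : [set a] :&: D :&: ([set b] :&: D) = set0.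
  by rewrite cards0 subn0.
apply/setP => z; rewrite !inE.
by case: (z =P a) => [->|] //; rewrite (negbTE ab) andbF.
Qed.

Lemma card2_pair A u : #|A| = 2 -> u \in A ->
  exists2 a, a != u & A = [set u; a].
Proof.
move=> cA uA; have : #|A :\ u| == 1 by have := cardsD1 u A; rewrite uA cA; lia.
case/cards1P => a E; exists a; last by rewrite -(setD1K uA) E.
have : a \in A :\ u by rewrite E set11.
by case/setD1P.
Qed.

(** Double counting: the members of [P] are disjoint, so each contributes its own [k] points of
    [D]. *)
Lemma card_setI_cover P D k : trivIset P ->
  (forall A, A \in P -> #|A :&: D| = k) -> #|D :&: cover P| = k * #|P|.
Proof.
move=> tP kP; rewrite -sum1_card.
under eq_bigl => i do rewrite inE andbC.
rewrite big_trivIset_cond // mulnC -sum_nat_const; apply: eq_bigr => A /kP <-.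
by rewrite -sum1_card; apply: eq_bigl => i; rewrite inE.
Qed.

(** A tournament on three vertices is a directed cycle, or it is transitive and then has both a
    source and a sink. The sink serves for [X], the source for its complement. *)
Lemma tournament3 (R : T -> T -> Prop) u v w :
  R u v \/ R v u -> R u w \/ R w u -> R v w \/ R w v ->
  ([/\ R u v, R v w & R w u] \/ [/\ R v u, R w v & R u w]) \/
  ([\/ R u v /\ R u w, R v u /\ R v w | R w u /\ R w v] /\
   [\/ R v u /\ R w u, R u v /\ R w v | R u w /\ R v w]).
Proof.
move=> [h1|h1] [h2|h2] [h3|h3];
  first [ by left; left | by left; right
        | right; split; first [ by constructor 1 | by constructor 2
                              | by constructor 3 ] ].
Qed.

End Pairs.

(** * Counting the pairs of a maximal family *)

Section MaximalFamily.
Variables (G : sgraph) (X : {set G}) (y1 y2 : G) (F : {set {set G}}).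
Hypotheses (clX : clique X) (clY : clique (~: X)).
Hypothesis nbr_uniq : forall x y y', x \in X -> y \notin X -> y' \notin X ->
  adj x y -> adj x y' -> y = y'.
Hypothesis nbr_two : forall x y, x \in X -> y \notin X -> adj x y ->
  y = y1 \/ y = y2.
Hypothesis card2F : forall A, A \in F -> #|A| = 2.
(** Two tokens are adjacent exactly when they share one vertex and their other ends are adjacent in
    [G]; [indepF] and [maxF] express independence and maximality in these terms. *)
Hypothesis indepF : forall a b c, b != a -> c != a ->
  [set a; b] \in F -> [set a; c] \in F -> ~~ adj b c.
Hypothesis maxF : forall a b, a != b -> [set a; b] \notin F ->
  exists c, [/\ c != a, [set a; c] \in F & adj b c] \/
            [/\ c != b, [set b; c] \in F & adj a c].

Let part k := [set A in F | #|A :&: X| == k].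

(** Each side is a clique, so distinct [a] and [b] would make the two pairs adjacent tokens. *)
Lemma mate_uniq u a b : a != u -> b != u -> (a \in X) = (b \in X) ->
  [set u; a] \in F -> [set u; b] \in F -> a = b.
Proof.
move=> au bu abX aF bF; apply/eqP/negPn/negP => ab.
have := indepF au bu aF bF; apply/negP/negPn.
case: (boolP (a \in X)) => aX; first by apply: clX; rewrite -?abX.
by apply: clY; rewrite ?inE -?abX.
Qed.

Lemma part_triv k : trivIset (part k).
Proof.
apply/trivIsetP => A B; rewrite !inE => /andP[AF /eqP Ak] /andP[BF /eqP Bk].
apply: contraNT => /pred0Pn[u /= /andP[uA uB]].
have [a au EA] := card2_pair (card2F AF) uA.
have [b bu EB] := card2_pair (card2F BF) uB.
rewrite EA EB in AF BF Ak Bk *.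
rewrite card_setI_pair 1?eq_sym // in Ak.
rewrite card_setI_pair 1?eq_sym // in Bk.
suff -> : a = b by [].
apply: mate_uniq au bu _ AF BF.
(* Once [u] is fixed, the count [k] determines the side of its mate. *)
by move: Ak Bk; case: (a \in X); case: (b \in X); case: (u \in X) => /=; lia.
Qed.

Lemma notin_cover_part k u a : u \notin cover (part k) -> a != u ->
  [set u; a] \in F -> (u \in X) + (a \in X) != k.
Proof.
move=> uC au aF; apply: contraNneq uC => E.
apply/bigcupP; exists [set u; a]; last exact: set21.
by rewrite inE aF card_setI_pair 1?eq_sym ?E ?eqxx.
Qed.

Lemma card_partX k : #|X :&: cover (part k)| = k * #|part k|.
Proof. by apply: card_setI_cover (part_triv k) _ => A; rewrite inE => /andP[_ /eqP]. Qed.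

Lemma card_partY k : #|~: X :&: cover (part k)| = (2 - k) * #|part k|.
Proof.
apply: card_setI_cover (part_triv k) _ => A; rewrite inE => /andP[AF /eqP <-].
by rewrite -(card2F AF) -setDE -(cardsID X A) addKn.
Qed.

Lemma card_family : #|F| = #|part 0| + #|part 1| + #|part 2|.
Proof.
rewrite -(cardsID (part 0) F) -(cardsID (part 1) (F :\: part 0)) addnA.
congr (_ + _ + _); apply: eq_card => A; rewrite !inE; case AF: (A \in F) => //=.
- by case: eqP => // ->.
- have : #|A :&: X| <= 2 by rewrite -(card2F AF) subset_leq_card // subsetIl.
  by case: #|_| => [|[|[|]]].
Qed.

(** If some [x] in [X] is missed, every missed [y] on the other side has its pair with [x] blocked,
    in one of two ways, and each way can occur for only one [y]. *)
Lemma card_part1 : odd #|X| -> odd #|~: X| -> #|X| < #|~: X| ->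
  #|part 1| = #|X|.
Proof.
move=> oX oY ltXY.
have := cardsID (cover (part 1)) X; have := cardsID (cover (part 1)) (~: X).
rewrite card_partX card_partY !mul1n => eY eX.
case: (posnP #|X :\: cover (part 1)|) => [z|]; first by lia.
rewrite card_gt0 => /set0Pn[x /setDP[xX xC]].
(* The two sides have odd sizes, so they differ by at least 2; as [part 1] covers equally many
   vertices of each, at least three are missed outside [X]. *)
have : #|~: X :\: cover (part 1)| > 2.
  have : X :\: cover (part 1) != set0 by apply/set0Pn; exists x; rewrite inE xC.
  by rewrite -card_gt0; lia.
case/card_gt2P => u [v [w [[uU vU wU] [uv vw wu]]]].
pose P1 y c := [/\ c != x, c \in X, [set x; c] \in F & adj y c].
pose P2 y c := [/\ c != y, c \notin X, [set y; c] \in F & adj x c].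
have blk y : y \in ~: X :\: cover (part 1) ->
    y \notin X /\ ((exists c, P1 y c) \/ (exists c, P2 y c)).
  case/setDP; rewrite inE => yX yC; split => //.
  have xy : x != y by apply: contraNneq yX => <-.
  have xyF : [set x; y] \notin F.
    apply/negP => h; have := notin_cover_part xC _ h.
    by rewrite eq_sym xy xX (negbTE yX) => /(_ isT).
  have [c [[cx cF yc]|[cy cF xc]]] := maxF xy xyF.
    left; exists c; split=> //; have := notin_cover_part xC cx cF.
    by rewrite xX; case: (c \in X).
  right; exists c; split=> //; have := notin_cover_part yC cy cF.
  by rewrite (negbTE yX); case: (c \in X).
(* The mate [c] of [x] inside [X] is unique, and so is the neighbour of [c] outside [X]. *)
have P1u y y' c c' : y \notin X -> y' \notin X -> P1 y c -> P1 y' c' -> y = y'.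
  move=> yX y'X [cx cX cF yc] [c'x c'X c'F yc'].
  have E : c = c' by apply: mate_uniq cx c'x _ cF c'F; rewrite cX c'X.
  by apply: (nbr_uniq cX yX y'X); rewrite adj_sym // E.
(* Here [c] is the only neighbour of [x] outside [X], and [y] is its unique mate there. *)
have P2u y y' c c' : y \notin X -> y' \notin X -> P2 y c -> P2 y' c' -> y = y'.
  move=> yX y'X [cy cX cF xc] [cy' c'X c'F xc'].
  have E := nbr_uniq xX c'X cX xc' xc; rewrite E in cy' c'F.
  apply: (mate_uniq (u := c)); rewrite 1?eq_sym // 1?setUC //.
  by rewrite (negbTE yX) (negbTE y'X).
have [uX bu] := blk _ uU; have [vX bv] := blk _ vU; have [wX bw] := blk _ wU.
move: uv vw wu.
case: bu bv bw => [[cu hu]|[cu hu]] [[cv hv]|[cv hv]] [[cw hw]|[cw hw]];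
  by first [ rewrite (P1u _ _ _ _ uX vX hu hv) eqxx
           | rewrite (P2u _ _ _ _ uX vX hu hv) eqxx
           | rewrite (P1u _ _ _ _ vX wX hv hw) eqxx
           | rewrite (P2u _ _ _ _ vX wX hv hw) eqxx
           | rewrite (P1u _ _ _ _ wX uX hw hu) eqxx
           | rewrite (P2u _ _ _ _ wX uX hw hu) eqxx ].
Qed.

(* [blocks u v]: a pair of [F] through [u] and the other side prevents
   [[set u; v]] from being added to [F]. *)
Let blocks u v := exists c, [/\ c != u, (c \in X) = (u \notin X),
  [set u; c] \in F & adj v c].

(** The boolean treats both sides at once: [b.*2] is 2 inside [X] and 0 outside. A blocking pair
    through an uncovered vertex lies in another part, so it crosses sides. *)
Lemma uncovered_blocks (b : bool) u v : (u \in X) = b -> (v \in X) = b ->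
  u \notin cover (part b.*2) -> v \notin cover (part b.*2) -> u != v ->
  blocks u v \/ blocks v u.
Proof.
move=> uX vX uC vC uv.
have uvF : [set u; v] \notin F.
  apply/negP => h; have := notin_cover_part uC _ h.
  by rewrite eq_sym uv uX vX addnn eqxx => /(_ isT).
have [c [[cu cF vc]|[cv cF uc]]] := maxF uv uvF; [left|right]; exists c; split=> //.
  by have := notin_cover_part uC cu cF; rewrite uX; case: b {uX vX uC vC}; case: (c \in X).
by have := notin_cover_part vC cv cF; rewrite vX; case: b {uX vX uC vC}; case: (c \in X).
Qed.

Lemma two_nbrs_pigeonhole u v w :
  u = y1 \/ u = y2 -> v = y1 \/ v = y2 -> w = y1 \/ w = y2 ->
  u != v -> v != w -> w != u -> False.
Proof. by move=> [->|->] [->|->] [->|->]; rewrite ?eqxx. Qed.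

(** Among three missed vertices, [blocks] contains a tournament. A vertex is blocked by at most one
    other, which rules out a sink; a cycle would need three distinct vertices outside [X] with
    neighbours in [X]. *)
Lemma card_part2 : odd #|X| -> #|part 2| = #|X|./2.
Proof.
move=> oX; have := cardsID (cover (part 2)) X; rewrite card_partX => eX.
(* The number of missed vertices is odd, so if it is at most 2 it equals 1. *)
case: (ltnP 2 #|X :\: cover (part 2)|) => [|small]; last by lia.
case/card_gt2P => u [v [w [[]]]].
move=> /setDP[uX uC] /setDP[vX vC] /setDP[wX wC] [uv vw wu].
have uw : u != w by rewrite eq_sym.
have src_eq a b c : a \in X -> b \in X -> c \notin X -> [set a; c] \in F ->
    [set b; c] \in F -> a = b.
  move=> aX bX cX aF bF; apply: (mate_uniq (u := c)); rewrite 1?setUC ?aX ?bX //.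
    by apply: contraNneq cX => <-.
  by apply: contraNneq cX => <-.
have indeg a b d : a \in X -> b \in X -> d \in X -> blocks a d -> blocks b d ->
    a = b.
  move=> aX bX dX [c [_ cX cF dc]] [c' [_ c'X c'F dc']].
  rewrite aX in cX; rewrite bX in c'X.
  have E := nbr_uniq dX (negbT cX) (negbT c'X) dc dc'.
  by apply: src_eq (negbT cX) cF _; rewrite // E.
have cyc a b d : a \in X -> b \in X -> d \in X -> a != b -> b != d -> d != a ->
    blocks a b -> blocks b d -> blocks d a -> False.
  move=> aX bX dX ab bd da [p [_ pX pF pb]] [q [_ qX qF qd]] [r [_ rX rF ra]].
  rewrite aX in pX; rewrite bX in qX; rewrite dX in rX.
  apply: (two_nbrs_pigeonhole (nbr_two bX (negbT pX) pb)
    (nbr_two dX (negbT qX) qd) (nbr_two aX (negbT rX) ra)).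
  - by apply: contraNneq ab => E; rewrite (src_eq a b p) ?pX // E.
  - by apply: contraNneq bd => E; rewrite (src_eq b d q) ?qX // E.
  - by apply: contraNneq da => E; rewrite (src_eq d a r) ?rX // E.
have blk a b : a \in X -> b \in X -> _ := @uncovered_blocks true a b.
have := tournament3 (blk u v uX vX uC vC uv) (blk u w uX wX uC wC uw)
  (blk v w vX wX vC wC vw).
case=> [[[h1 h2 h3]|[h1 h2 h3]]|[_ [[h1 h2]|[h1 h2]|[h1 h2]]]].
- by case: (cyc u v w).
- by case: (cyc u w v); rewrite // 1?eq_sym.
- by rewrite (indeg v w u) ?eqxx in vw.
- by rewrite (indeg u w v) ?eqxx in uw.
- by rewrite (indeg u v w) ?eqxx in uv.
Qed.

(** Dual to the count inside [X]: a vertex blocks at most one other, since its mate in [X] has a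
    single neighbour outside, so there is no source. In a cycle all three vertices would have
    neighbours in [X]. *)
Lemma card_part0 : odd #|~: X| -> #|part 0| = #|~: X|./2.
Proof.
move=> oY; have := cardsID (cover (part 0)) (~: X).
rewrite card_partY subn0 => eY.
case: (ltnP 2 #|~: X :\: cover (part 0)|) => [|small]; last by lia.
case/card_gt2P => u [v [w [[]]]].
move=> /setDP[+ uC] /setDP[+ vC] /setDP[+ wC] [uv vw wu].
rewrite !inE => uX vX wX; have uw : u != w by rewrite eq_sym.
have outdeg a b d : a \notin X -> b \notin X -> d \notin X ->
    blocks a b -> blocks a d -> b = d.
  move=> aX bX dX [c [ca cX cF bc]] [c' [c'a c'X c'F dc']].
  have E : c = c' by apply: mate_uniq ca c'a _ cF c'F; rewrite cX c'X.
  rewrite aX in cX.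
  by apply: (nbr_uniq cX bX dX); rewrite adj_sym // E.
have tgt a b : a \notin X -> b \notin X -> blocks a b -> b = y1 \/ b = y2.
  move=> aX bX [c [_ cX _ bc]]; rewrite aX in cX.
  by apply: nbr_two cX bX _; rewrite adj_sym.
have blk a b : a \notin X -> b \notin X -> _ :=
  fun aX bX => @uncovered_blocks false a b (negbTE aX) (negbTE bX).
have := tournament3 (blk u v uX vX uC vC uv) (blk u w uX wX uC wC uw)
  (blk v w vX wX vC wC vw).
case=> [[[h1 h2 h3]|[h1 h2 h3]]|[[[h1 h2]|[h1 h2]|[h1 h2]] _]].
- by case: (two_nbrs_pigeonhole (tgt _ _ wX uX h3) (tgt _ _ uX vX h1)
    (tgt _ _ vX wX h2)).
- by case: (two_nbrs_pigeonhole (tgt _ _ vX uX h1) (tgt _ _ wX vX h2)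
    (tgt _ _ uX wX h3)).
- by rewrite (outdeg u v w) ?eqxx in vw.
- by rewrite (outdeg v u w) ?eqxx in uw.
- by rewrite (outdeg w u v) ?eqxx in uv.
Qed.

Lemma card_maximal_family : odd #|X| -> odd #|~: X| -> #|X| < #|~: X| ->
  #|F| = #|~: X|./2 + #|X| + #|X|./2.
Proof.
by move=> oX oY lt; rewrite card_family card_part0 // card_part1 // card_part2.
Qed.

End MaximalFamily.

(** * From independent sets of the token graph to families of pairs *)

Section TokenGraph.
Variable G : sgraph.
Implicit Types (a b c u v : G) (e : token G 2).

Lemma symdiff_pair a b c : b != a -> c != a -> b != c ->
  symdiff [set a; b] [set a; c] = [set b; c].
Proof.
move=> ba ca bc; apply/setP => z; rewrite !inE.
case: (eqVneq z a) => [->|]; first by rewrite ?eqxx /= (eq_sym a b) (eq_sym a c) (negbTE ba) (negbTE ca).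
by case: (eqVneq z b) => [->|] /=; rewrite ?(negbTE bc) //; case: (z == c).
Qed.

Lemma adj_pair b c u v : adj u v -> b != c -> [set b; c] = [set u; v] ->
  adj b c.
Proof.
move=> uv bc E; have := set21 b c; have := set22 b c; rewrite E !inE.
by case/orP=> /eqP cE /orP[] /eqP bE; rewrite cE bE ?eqxx // in bc *; rewrite adj_sym.
Qed.

Lemma token_adj_shared a b c e e' : b != a -> c != a ->
  val e = [set a; b] -> val e' = [set a; c] -> adj b c -> token_adj e e'.
Proof.
move=> ba ca eE e'E bc; apply/existsP; exists b; apply/existsP; exists c.
rewrite bc eE e'E symdiff_pair ?eqxx //.
by apply: contraTneq bc => ->; rewrite adj_irr.
Qed.

Lemma token_adj_pair a b e e' : a != b -> val e = [set a; b] ->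
  token_adj e e' -> exists c,
    [/\ c != a, val e' = [set a; c] & adj b c] \/
    [/\ c != b, val e' = [set b; c] & adj a c].
Proof.
move=> ab eE ee'.
have ne : val e' != val e.
  by apply: contraTneq ee' => /val_inj ->; rewrite token_adj_irr.
have ce' : #|val e'| = 2 by apply/eqP; apply: (valP e').
case/existsP: ee' => u /existsP[v /andP[uv /eqP E]].
have shared a' b' : a' != b' -> val e = [set a'; b'] -> a' \in val e' ->
    exists c, [/\ c != a', val e' = [set a'; c] & adj b' c].
  move=> ab' eE' ae'; have [c ca cE] := card2_pair ce' ae'.
  have bc : b' != c by apply: contraNneq ne => bc; rewrite cE eE' bc.
  exists c; split=> //; apply: adj_pair uv (bc) _.
  by rewrite -E eE' cE symdiff_pair //; rewrite eq_sym.
case: (boolP (a \in val e')) => ae'.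
  by have [c hc] := shared a b ab eE ae'; exists c; left.
case: (boolP (b \in val e')) => be'.
  have [||c hc] := shared b a _ _ be'; [by rewrite eq_sym|by rewrite setUC|].
  by exists c; right.
(* If the tokens were disjoint, [val e] would fill the two-element symmetric difference, leaving no
   room for [val e'] outside [val e]. *)
case/eqP: ne; apply/eqP; rewrite eqEcard ce' (eqP (valP e)) leqnn andbT.
have sub : val e \subset [set u; v].
  by rewrite -E eE subUset !sub1set !inE ae' be' !eqxx orbT.
have /eqP <- : [set u; v] == val e.
  by rewrite eq_sym eqEcard sub (eqP (valP e)) cards2; case: (u != v).
apply/subsetP => z zE; case: (boolP (z \in val e)) => ze.
  exact: subsetP sub z ze.
by rewrite -E !inE zE ze.
Qed.

Lemma card_maxset_token (X : {set G}) (y1 y2 : G) (S : {set token_graph G 2}) :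
  clique X -> clique (~: X) ->
  (forall x y y', x \in X -> y \notin X -> y' \notin X ->
    adj x y -> adj x y' -> y = y') ->
  (forall x y, x \in X -> y \notin X -> adj x y -> y = y1 \/ y = y2) ->
  odd #|X| -> odd #|~: X| -> #|X| < #|~: X| ->
  maxset (@indep (token_graph G 2)) S ->
  #|S| = #|~: X|./2 + #|X| + #|X|./2.
Proof.
move=> clX clY nu nt oX oY lt /maxsetP[iS mS].
have ind e e' : e \in S -> e' \in S -> ~~ token_adj e e'.
  by move=> eS e'S; move/forall_inP: iS => /(_ e eS) /forall_inP /(_ e' e'S).
pose F : {set {set G}} := [set val (e : token G 2) | e in S].
rewrite -(card_imset (mem S) (val_inj : injective (val : token G 2 -> _))).
apply: (@card_maximal_family G X y1 y2 F) => //.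
- by move=> A /imsetP[e _ ->]; apply/eqP; apply: (valP e).
- move=> a b c ba ca /imsetP[e eS eE] /imsetP[e' e'S e'E].
  by apply: contra (ind _ _ eS e'S) => /(token_adj_shared ba ca (esym eE) (esym e'E)).
move=> a b ab abF.
have ab2 : #|[set a; b]| == 2 by rewrite cards2 ab.
pose e : token_graph G 2 := (exist _ [set a; b] ab2 : token G 2).
have eS : e \notin S by apply: contra abF => eS; apply/imsetP; exists e.
(* Otherwise [e |: S] is independent, and maximality puts [e] in [S]. *)
have [e' e'S ee'] : exists2 e', e' \in S & adj e e'.
  apply/exists_inP; apply: contraNT eS; rewrite negb_exists_in => /forall_inP free.
  rewrite -(mS (e |: S)) ?setU11 ?subsetUr //.
  apply/forall_inP => p /setU1P[->|pS]; apply/forall_inP => q /setU1P[->|qS].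
  + by rewrite adj_irr.
  + exact: free.
  + by rewrite adj_sym; apply: free.
  + exact: ind.
have [c hc] := token_adj_pair ab (erefl : val (e : token G 2) = _) ee'.
exists c; case: hc => [[h1 h2 h3]|[h1 h2 h3]]; [left|right]; split=> //;
  by apply/imsetP; exists e'.
Qed.

End TokenGraph.

(** * The neighbourhood pattern of the two cliques *)

Theorem theorem6p9 (G : sgraph) (m n s t : nat)
    (x : 'I_m -> G) (y : 'I_n -> G)
    (hG : two_cliques x y)
    (lt_mn : m < n) (odd_n : odd n) (odd_m : odd m)
    (le_st : s + t <= m)
    (Ny1 : forall j : 'I_n, j = 0 :> nat ->
       cl_nbhd (y j) = [set x i | i : 'I_m & i < s] :|: [set y k | k : 'I_n])
    (Ny2 : forall j : 'I_n, j = 1 :> nat ->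
       cl_nbhd (y j) =
         [set x i | i : 'I_m & s <= i < s + t] :|: [set y k | k : 'I_n])
    (Ny : forall j : 'I_n, 2 <= j -> cl_nbhd (y j) = [set y k | k : 'I_n]) :
  well_covered (token_graph G 2).
Proof.
case: hG => _ injx injy disj cov clX clY.
set X := [set x i | i : 'I_m] in disj cov clX.
set Y := [set y k | k : 'I_n] in disj cov clY Ny1 Ny2 Ny.
have YE : ~: X = Y.
  apply/setP => z; rewrite !inE; have := in_setT z; rewrite -cov inE.
  case: (boolP (z \in X)) => //= zX _.
  by rewrite (disjointFr disj).
have cX : #|X| = m by rewrite card_imset // card_ord.
have cY : #|~: X| = n by rewrite YE card_imset // card_ord.
have xNY i : x i \notin Y by rewrite -YE inE negbK imset_f.
have nbr i j : adj (x i) (y j) ->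
    (j = 0 :> nat /\ i < s) \/ (j = 1 :> nat /\ s <= i).
  move=> xy; have xN : x i \in cl_nbhd (y j) by rewrite !inE adj_sym xy orbT.
  case: (ltnP 1 j) => [/Ny E|]; first by rewrite E (negbTE (xNY i)) in xN.
  rewrite leq_eqVlt ltnS leqn0 => /orP[] /eqP j0; [right|left]; split=> //.
    move: xN; rewrite (Ny2 _ j0) inE (negbTE (xNY i)) orbF.
    by case/imsetP => k; rewrite inE => /andP[sk _] /injx ->.
  move: xN; rewrite (Ny1 _ j0) inE (negbTE (xNY i)) orbF.
  by case/imsetP => k; rewrite inE => ks /injx ->.
have n0 : 0 < n by lia.
have n1 : 1 < n by lia.
have NX z : z \notin X -> exists j, z = y j.
  by rewrite -in_setC YE => /imsetP[j _ ->]; exists j.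
(* The index ranges [i < s] and [s <= i] exclude each other, so [x i] cannot be adjacent to both of
   the first two vertices of [Y]. *)
have nu a b b' : a \in X -> b \notin X -> b' \notin X ->
    adj a b -> adj a b' -> b = b'.
  move=> /imsetP[i _ ->] /NX[j ->] /NX[j' ->] /nbr h /nbr h'.
  by congr y; apply: val_inj => /=; lia.
have nt a b : a \in X -> b \notin X -> adj a b ->
    b = y (Ordinal n0) \/ b = y (Ordinal n1).
  move=> /imsetP[i _ ->] /NX[j ->] /nbr[[j0 _]|[j1 _]]; [left|right];
  by congr y; apply: val_inj.
have clY' : clique (~: X) by rewrite YE.
move=> A B mA mB.
by rewrite !(card_maxset_token clX clY' nu nt) ?cX ?cY.
Qed.
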